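(* Let $N,m$ be positive integers and let $p_1,\dots,p_N>0$ with $\sum_{j=1}^Np_j=1$. Let $T_m(N)$ be the coupon-collector variable with coupon probabilities $p_1,\dots,p_N$. Then for every $r=1,2,\dots$, $$E\left[T_m(N)^{(r)}\right]=r\int_0^\infty\left\{1-\prod_{j=1}^N\left[1-S_m(p_jt)e^{-p_jt}\right]\right\}t^{r-1}\,dt.$$
   Context: Coupon collector setting: coupons of $N$ types are drawn independently with replacement, type $j$ having probability $p_j$. $T_m(N)$ is the number of draws needed until every one of the $N$ types has been drawn at least $m$ times. $E$ denotes expectation. $M^{(r)}:=M(M+1)\cdots(M+r-1)$ is the rising factorial, and $S_m(y)=\sum_{l=0}^{m-1}\frac{y^l}{l!}$. *)

(* Defs.v *)
From HB Require Import structures.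
From mathcomp Require Import all_boot all_order all_algebra.
From mathcomp Require Import all_classical all_reals all_analysis.

Set Implicit Arguments.
Unset Strict Implicit.
Unset Printing Implicit Defensive.

Import Order.TTheory GRing.Theory Num.Theory.
Import numFieldNormedType.Exports.

Local Open Scope classical_set_scope.
Local Open Scope ring_scope.

(* Mutual independence of a family of random variables with values in [C],
   where [C] carries the discrete sigma-algebra (every subset is an event):
   the product rule over every finite subfamily. *)
Definition mutually_independent d (Omega : measurableType d) (R : realType)
    (P : probability Omega R) (I : choiceType) (C : Type)
    (X : I -> Omega -> C) : Prop :=
  forall (s : seq I) (A : I -> set C), uniq s ->
    P (\bigcap_(i in [set` s]) (X i @^-1` A i)) =
    (\big[*%E/1%E]_(i <- s) P (X i @^-1` A i))%E.

(* [X k] is the type of the (k+1)-st coupon drawn.  Since ['I_N] carries no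
   canonical measurableType structure, measurability of the draws is stated
   for the discrete sigma-algebra on ['I_N]. *)
Definition coupon_draws d (Omega : measurableType d) (R : realType)
    (P : probability Omega R) (N : nat) (p : 'I_N -> R)
    (X : nat -> Omega -> 'I_N) : Prop :=
  [/\ forall k (A : set 'I_N), measurable (X k @^-1` A),
      mutually_independent P X &
      forall k j, P (X k @^-1` [set j]) = (p j)%:E].

Definition num_drawn (Omega : Type) (N : nat) (X : nat -> Omega -> 'I_N)
    (n : nat) (j : 'I_N) (w : Omega) : nat :=
  #|[pred k : 'I_n | X k w == j]|.

(* The infimum of the empty set being [+oo], [collection_time] is [+oo] on the
   event that some type is drawn fewer than [m] times in the whole sequence. *)
Definition collection_time (R : realType) (Omega : Type) (N : nat)
    (X : nat -> Omega -> 'I_N) (m : nat) (w : Omega) : \bar R :=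
  ereal_inf [set (n%:R)%:E | n in
    [set n : nat | forall j : 'I_N, (m <= num_drawn X n j w)%N]].

Definition rising_factorial (R : realType) (x : \bar R) (r : nat) : \bar R :=
  (\big[*%E/1%E]_(i < r) (x + (i%:R)%:E))%E.

Definition exp_partial_sum (R : realType) (m : nat) (y : R) : R :=
  \sum_(l < m) y ^+ l / (l`!)%:R.

(* Main.v *)
(* Poissonization.  Summing the increments r (n+1)^(r-1) of n^(r) over n < T
   gives E[T^(r)] = sum_n r (n+1)^(r-1) P(T > n).  If q_n(a) is the probability
   that n draws contain at least a_j coupons of each type j, then conditioning
   on the first draw gives q_(n+1)(a) = sum_j p_j q_n(a - e_j), which is also
   the recursion satisfied by the successive derivatives at 0 of
     H_a(t) = prod_j (exp(p_j t) - S_(a_j)(p_j t)).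
   Hence H_a(t) = sum_n q_n(a) t^n / n!, and the integrand is
     sum_n P(T > n) exp(-t) t^(n+r-1) / n!,
   whose terms integrate to P(T > n) (n+r-1)! / n! = P(T > n) (n+1)^(r-1). *)
Require Import Defs.
From HB Require Import structures.
From mathcomp Require Import all_boot all_order all_algebra.
From mathcomp Require Import all_classical all_reals all_analysis.
From mathcomp Require Import measurable_realfun ring.

Set Implicit Arguments.
Unset Strict Implicit.
Unset Printing Implicit Defensive.

Import Order.TTheory GRing.Theory Num.Theory.
Import numFieldNormedType.Exports.

Local Open Scope classical_set_scope.
Local Open Scope ring_scope.

(** * Truncated exponential generating functions and tails of the exponential series *)

Section ExponentialGeneratingFunctions.
Variable R : realType.
Implicit Types (t : R) (c : nat -> R).

(** Reduces an inequality on the half-line to one between derivatives and an equality at [0]; the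
    bounds below follow from it by induction on the order. *)
Lemma derive_ge0_ge0 (f df : R -> R) t :
  (forall x : R, is_derive x 1 f (df x)) -> (forall x, 0 <= x -> 0 <= df x) ->
  f 0 = 0 -> 0 <= t -> 0 <= f t.
Proof.
move=> fdf df_ge0 f0 t_ge0; rewrite -f0.
have dF (x : R) : derivable f x 1 by case: (fdf x).
apply: (@ger0_derive1_ndecry R f 0) => // [x|].
  rewrite in_itv/= andbT => x_gt0.
  by rewrite derive1E (@derive_val _ _ _ _ _ _ _ (fdf x)) df_ge0 // ltW.
by apply: derivable_within_continuous => x _.
Qed.

Lemma is_derive_prod (I : eqType) (s : seq I) (f : I -> R -> R) (df : I -> R) t :
  uniq s -> (forall i, is_derive t 1 (f i) (df i)) ->
  is_derive t 1 (fun u => \prod_(i <- s) f i u)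
    (\sum_(j <- s) \prod_(i <- s) (if i == j then df i else f i t)).
Proof.
move=> + fdf; elim: s => [_|i s IHs /= /andP[iNs s_uniq]].
  rewrite big_nil (_ : (fun u => _) = cst 1); first exact: is_derive_cst.
  by apply/funext => u; rewrite big_nil.
rewrite (_ : (fun u => _) = f i * (fun u => \prod_(j <- s) f j u)); last first.
  by apply/funext => u; rewrite big_cons.
apply: is_derive_eq; first by apply: is_deriveM; exact: IHs.
rewrite big_cons big_cons eqxx addrC; congr (_ + _).
  rewrite /GRing.scale/= mulrC; congr (_ * _); apply: eq_big_seq => k ks.
  by case: eqP ks iNs => // -> ->.
rewrite /GRing.scale/= mulr_sumr; apply: eq_big_seq => k ks.
by rewrite big_cons; case: eqP ks iNs => // -> ->.
Qed.

Definition exp_poly c n t : R := \sum_(k < n) c k * (t ^+ k / k`!%:R).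

Lemma exp_poly_at0 c n : exp_poly c n.+1 0 = c 0%N.
Proof.
rewrite /exp_poly big_ord_recl big1 ?addr0 => [|k _].
  by rewrite expr0 fact0 divr1 mulr1.
by rewrite expr0n mul0r mulr0.
Qed.

Lemma is_derive_exp_poly c n t :
  is_derive t 1 (exp_poly c n.+1) (exp_poly (fun k => c k.+1) n t).
Proof.
elim: n => [|n IHn].
  rewrite (_ : exp_poly c 1 = cst (c 0%N)); last first.
    apply/funext => u.
    by rewrite /exp_poly big_ord1 expr0 fact0 divr1 mulr1.
  by rewrite /exp_poly big_ord0; exact: is_derive_cst.
rewrite (_ : exp_poly c n.+2 =
    exp_poly c n.+1 + (c n.+1 / n.+1`!%:R) \*: (id ^+ n.+1)); last first.
  apply/funext => u; rewrite /exp_poly big_ord_recr/=; congr (_ + _).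
  by rewrite exprfctE /= -[RHS]/(_ * _) !mulrA mulrAC.
apply: is_derive_eq.
rewrite [in RHS]/exp_poly big_ord_recr /=; congr (_ + _).
rewrite -[LHS]/(c n.+1 / n.+1`!%:R * ((n.+1%:R * t ^+ n) * 1)) factS natrM.
by field; rewrite -[1]/(1%:R) -natrD !pnatr_eq0 -lt0n fact_gt0.
Qed.

Lemma exp_partial_sumE m t : exp_partial_sum m t = exp_poly (fun=> 1) m t.
Proof. by apply: eq_bigr => l _; rewrite mul1r. Qed.

Definition exp_tail m t : R := expR t - exp_partial_sum m t.

(** The convention [0.-1 = 0] is the right one here: [exp_tail 0] is the exponential, its own
    derivative. *)
Lemma is_derive_exp_tail m t : is_derive t 1 (exp_tail m) (exp_tail m.-1 t).
Proof.
have -> : exp_tail m = expR - exp_poly (fun=> 1) m.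
  by apply/funext => u; rewrite /exp_tail exp_partial_sumE.
rewrite /exp_tail exp_partial_sumE.
case: m => [|m]; last by apply: is_deriveB; exact: is_derive_exp_poly.
have -> : exp_poly (fun=> 1) 0 = cst 0.
  by apply/funext => u; rewrite /exp_poly big_ord0.
by apply: is_deriveB.
Qed.

Lemma exp_tail_at0 m : exp_tail m 0 = (m == 0%N)%:R.
Proof.
rewrite /exp_tail exp_partial_sumE expR0; case: m => [|m].
  by rewrite /exp_poly big_ord0 subr0.
by rewrite exp_poly_at0 subrr.
Qed.

Lemma exp_tail_ge0 m t : 0 <= t -> 0 <= exp_tail m t.
Proof.
elim: m t => [|m IHm] t t_ge0.
  by rewrite /exp_tail exp_partial_sumE /exp_poly big_ord0 subr0 expR_ge0.
apply: (@derive_ge0_ge0 _ (exp_tail m)) => //.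
  exact: is_derive_exp_tail.
by rewrite exp_tail_at0.
Qed.

Lemma exp_tail_le_expR m t : 0 <= t -> exp_tail m t <= expR t.
Proof.
move=> t_ge0; rewrite /exp_tail lerBlDr lerDl sumr_ge0 // => l _.
by rewrite divr_ge0 // exprn_ge0.
Qed.

Lemma cvg_exp_tail t : exp_tail n t @[n --> \oo] --> (0 : R).
Proof.
rewrite -(subrr (expR t)); apply: cvgB; first exact: cvg_cst.
rewrite (_ : (fun n => _) = series (exp_coeff t)); last first.
  by apply/funext => n; rewrite /series /= big_mkord; apply: eq_bigr.
exact: is_cvg_series_exp_coeff.
Qed.

End ExponentialGeneratingFunctions.

(** * Taylor expansion at [0] of a product of exponential tails *)

Section Poissonization.
Variables (R : realType) (N : nat) (p : 'I_N -> R).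
Hypotheses (p_ge0 : forall j, 0 <= p j) (p_sum1 : \sum_(j < N) p j = 1).
Implicit Types (a : 'I_N -> nat) (t : R).

(** The predecessor is truncated: a coupon of a type already complete changes nothing. *)
Definition decr a (j : 'I_N) : 'I_N -> nat :=
  fun i => if i == j then (a i).-1 else a i.

(* The probability that [n] independent draws contain at least [a j] coupons
   of type [j] for every [j], by conditioning on the first draw. *)
Fixpoint covering_prob (n : nat) a : R :=
  if n is n'.+1 then \sum_(j < N) p j * covering_prob n' (decr a j)
  else [forall j, a j == 0%N]%:R.

Lemma covering_prob_itv n a : 0 <= covering_prob n a <= 1.
Proof.
elim: n a => [|n IHn] a /=; first by rewrite ler0n lern1 leq_b1.
apply/andP; split.
  by apply: sumr_ge0 => j _; rewrite mulr_ge0 //; case/andP: (IHn (decr a j)).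
rewrite -p_sum1; apply: ler_sum => j _.
by rewrite ler_piMr //; case/andP: (IHn (decr a j)).
Qed.

(** The function [H_a], to be identified with the exponential generating function of
    [covering_prob p n a] in [n]. *)
Definition prod_exp_tail a t : R := \prod_(j < N) exp_tail (a j) (p j * t).

Lemma is_derive_prod_exp_tail a t :
  is_derive t 1 (prod_exp_tail a) (\sum_(j < N) p j * prod_exp_tail (decr a j) t).
Proof.
have dtail j : is_derive t 1 (fun u => exp_tail (a j) (p j * u))
    (p j * exp_tail (a j).-1 (p j * t)).
  rewrite mulrC.
  apply: (@is_derive1_comp R (exp_tail (a j)) (fun u => p j * u)).
    exact: is_derive_exp_tail.
  rewrite -[X in is_derive _ _ _ X]mulr1.
  exact: (is_deriveZ (p j) (is_derive_id t (1 : R))).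
apply: is_derive_eq; first exact: is_derive_prod (index_enum_uniq _) dtail.
apply: eq_bigr => j _.
rewrite /prod_exp_tail (bigD1 j) //= eqxx -mulrA; congr (_ * _).
rewrite [in RHS](bigD1 j) //= /decr eqxx; congr (_ * _).
by apply: eq_bigr => i /negbTE ->.
Qed.

Lemma prod_exp_tail_at0 a : prod_exp_tail a 0 = [forall j, a j == 0%N]%:R.
Proof.
rewrite /prod_exp_tail.
under eq_bigr do rewrite mulr0 exp_tail_at0.
case: forallP => [a0|/forallP]; first by apply: big1 => j _; rewrite a0.
rewrite negb_forall => /existsP[j /negbTE aj].
by rewrite (bigD1 j) //= aj mul0r.
Qed.

(** Each factor lies between [0] and [exp(p_j t)], and these exponentials multiply to [exp(t)]
    because the [p_j] sum to [1]. *)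
Lemma prod_exp_tail_itv a t : 0 <= t -> 0 <= prod_exp_tail a t <= expR t.
Proof.
move=> t_ge0; have pt_ge0 j : 0 <= p j * t by rewrite mulr_ge0.
rewrite prodr_ge0 => [|j _]; last exact: exp_tail_ge0.
rewrite /= -[in leRHS](mul1r t) -p_sum1 mulr_suml expR_sum.
by apply: ler_prod => j _; rewrite exp_tail_ge0 //= exp_tail_le_expR.
Qed.

(* Induction on [n]: at order [n.+1] the remainder and its upper bound vanish at
   [0], and the derivative of the remainder is the average, with weights [p j],
   of the remainders of order [n] at [decr a j]. *)
Lemma prod_exp_tail_remainder n a t : 0 <= t ->
  0 <= prod_exp_tail a t - exp_poly (fun k => covering_prob k a) n t
    <= exp_tail n t.
Proof.
elim: n a t => [|n IHn] a t t_ge0.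
  rewrite /exp_tail exp_partial_sumE /exp_poly !big_ord0 !subr0.
  exact: prod_exp_tail_itv.
pose rem a n t := prod_exp_tail a t - exp_poly (fun k => covering_prob k a) n t.
have drem (x : R) : is_derive x 1 (rem a n.+1) (\sum_(j < N) p j * rem (decr a j) n x).
  apply: is_derive_eq.
    apply: is_deriveB; first exact: is_derive_prod_exp_tail.
    exact: is_derive_exp_poly.
  rewrite /rem /exp_poly; under [RHS]eq_bigr do rewrite mulrBr mulr_sumr.
  rewrite sumrB exchange_big /=; congr (_ - _); apply: eq_bigr => k _.
  by rewrite mulr_suml; apply: eq_bigr => j _; rewrite -mulrA.
have rem0 : rem a n.+1 0 = 0.
  by rewrite /rem prod_exp_tail_at0 exp_poly_at0 subrr.
apply/andP; split.
  apply: (derive_ge0_ge0 drem) => // x x_ge0.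
  by apply: sumr_ge0 => j _; rewrite mulr_ge0 //; case/andP: (IHn (decr a j) x x_ge0).
rewrite -subr_ge0.
apply: (@derive_ge0_ge0 R (exp_tail n.+1 - rem a n.+1)
  (fun x => exp_tail n x - \sum_(j < N) p j * rem (decr a j) n x)) => //.
- by move=> x; apply: is_deriveB; exact: is_derive_exp_tail.
- move=> x x_ge0; rewrite -[exp_tail n x]mul1r -p_sum1 mulr_suml -sumrB.
  apply: sumr_ge0 => j _; rewrite -mulrBr mulr_ge0 // subr_ge0.
  by case/andP: (IHn (decr a j) x x_ge0).
- by rewrite -[LHS]/(exp_tail n.+1 0 - rem a n.+1 0) rem0 exp_tail_at0 subr0.
Qed.

End Poissonization.

(** * Covering events, decomposed along their first draw *)

Section Covering.
Variables (Omega : Type) (N : nat) (X : nat -> Omega -> 'I_N).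
Implicit Type a : 'I_N -> nat.

(** The offset [k] lets the draws left after the first one form an event of the same kind; a sum
    over draws, unlike a cardinal, splits off its first term directly. *)
Definition covering k n a : set Omega :=
  [set w | forall j, (a j <= \sum_(i < n) (X (k + i)%N w == j))%N].

Lemma covering0 k a :
  covering k 0 a = if [forall j, a j == 0%N] then setT else set0.
Proof.
case: ifPn => [/forallP a0|/negP a0]; apply/seteqP; split=> w //=.
  by move=> _ j; rewrite (eqP (a0 j)).
by move=> cov; apply: a0; apply/forallP => j; have := cov j; rewrite big_ord0 leqn0.
Qed.

Lemma coveringS k n a :
  covering k n.+1 a =
  \bigcup_j (X k @^-1` [set j] `&` covering k.+1 n (decr a j)).
Proof.
have countE w j : (\sum_(i < n.+1) (X (k + i)%N w == j) =
    (X k w == j) + \sum_(i < n) (X (k.+1 + i)%N w == j))%N.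
  by rewrite big_ord_recl addn0; under eq_bigr do rewrite /= /bump /= addnA addn1.
apply/seteqP; split=> w /=.
  move=> cov; exists (X k w) => //; split=> //= j.
  have := cov j; rewrite countE /decr eq_sym.
  by case: eqP => _; rewrite ?add0n // -subn1 leq_subLR.
move=> [j _ [/= Xj cov] i]; have := cov i; rewrite countE /decr Xj eq_sym.
by case: eqP => _; rewrite ?add0n // -subn1 leq_subLR.
Qed.

End Covering.

(** * Probabilities of covering events under independent draws *)

Section Draws.
Context d (Omega : measurableType d) (R : realType) (P : probability Omega R).
Variables (N : nat) (p : 'I_N -> R) (X : nat -> Omega -> 'I_N).
Hypothesis drawsX : coupon_draws P p X.
Implicit Types (a : 'I_N -> nat) (c : nat -> 'I_N).

Definition cylinder c k : set Omega := [set w | forall i, (i < k)%N -> X i w = c i].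

(** The shape to which [mutually_independent] applies: an intersection over a duplicate-free
    sequence of indices. *)
Lemma cylinder_bigcap c k :
  cylinder c k = \bigcap_(i in [set` iota 0 k]) (X i @^-1` [set c i]).
Proof.
apply/seteqP; split=> w /= cw i /=; first by rewrite mem_iota => /cw.
by move=> ik; apply: cw; rewrite /= mem_iota.
Qed.

Lemma measurable_cylinder c k : measurable (cylinder c k).
Proof.
have [mX _ _] := drawsX; rewrite cylinder_bigcap.
by apply: bigcap_measurableType => i _; exact: mX.
Qed.

Lemma probability_cylinder c k : P (cylinder c k) = (\prod_(i < k) p (c i))%:E.
Proof.
have [_ indepX lawX] := drawsX.
rewrite cylinder_bigcap indepX ?iota_uniq //.
rewrite -{1}(subn0 k) -/(index_iota 0 k) big_mkord -prodEFin.
by apply: eq_bigr => i _; exact: lawX.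
Qed.

Lemma measurable_covering k n a : measurable (covering X k n a).
Proof.
have [mX _ _] := drawsX.
elim: n k a => [|n IHn] k a; first by rewrite covering0; case: ifP.
rewrite coveringS; apply: fin_bigcup_measurable => // j _.
by apply: measurableI; [exact: mX|exact: IHn].
Qed.

(* The cylinder is what makes the induction on [n] go through: it absorbs the
   value of the draw [k] on which one conditions. *)
Lemma probability_cylinderI_covering c k n a :
  P (cylinder c k `&` covering X k n a) =
  ((\prod_(i < k) p (c i)) * covering_prob p n a)%:E.
Proof.
have [mX _ _] := drawsX.
elim: n k c a => [|n IHn] k c a.
  rewrite covering0 /=; case: ifP => _.
    by rewrite setIT mulr1 probability_cylinder.
  by rewrite setI0 mulr0 measure0.
(* Overwriting [c] at position [k] with the drawn type [j] turns the conditioning on that draw into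
   a cylinder one step longer. *)
pose extend j i := if i == k then j else c i.
have cylS j : cylinder c k `&` X k @^-1` [set j] = cylinder (extend j) k.+1.
  apply/seteqP; split=> w /=.
    move=> [cw Xj] i; rewrite ltnS /extend; case: ltngtP => // [ik _|-> _ //].
    exact: cw.
  move=> cw; split=> [i ik|]; last by have := cw k (ltnSn k); rewrite /extend eqxx.
  by have := cw i (ltnW ik); rewrite /extend ltn_eqF.
have prodS j : \prod_(i < k.+1) p (extend j i) = (\prod_(i < k) p (c i)) * p j.
  rewrite big_ord_recr /= /extend eqxx; congr (_ * _).
  by apply: eq_bigr => i _; rewrite ltn_eqF.
have allI : [set: 'I_N] = [set` index_enum 'I_N].
  by apply/seteqP; split=> j //= _; rewrite mem_index_enum.
rewrite coveringS setI_bigcupr allI bigcup_seq measure_bigsetU_ord_cond.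
- rewrite /= mulr_sumr -sumEFin; apply: eq_bigr => j _.
  by rewrite setIA cylS IHn prodS mulrA.
- move=> j _; apply: measurableI; first exact: measurable_cylinder.
  by apply: measurableI; [exact: mX|exact: measurable_covering].
- by move=> i j _ _ [w [[_ [/= <- _]] [_ [/= <- _]]]].
Qed.

End Draws.

(** * Rising factorials and hitting times *)

Definition rising_nat n r : nat := \prod_(i < r) (n + i)%N.

(** Both rising factorials of order [r.+1] contain [(n+1)...(n+r)]; the remaining factors satisfy
    [n + 1 + r = n + (r + 1)]. *)
Lemma rising_natSS n r :
  rising_nat n.+1 r.+1 = (rising_nat n r.+1 + r.+1 * rising_nat n.+1 r)%N.
Proof.
rewrite {1}/rising_nat big_ord_recr /= -/(rising_nat n.+1 r).
rewrite [rising_nat n _]big_ord_recl /= addn0.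
under [X in _ = (n * X + _)%N]eq_bigr do rewrite -addSnnS.
by rewrite -/(rising_nat n.+1 r) -mulnDl mulnC addSnnS.
Qed.

(** Matches the gamma integral [(n+r)!], divided by [n!], with the increments of the rising
    factorial. *)
Lemma rising_natS_fact n r : (rising_nat n.+1 r * n`! = (n + r)`!)%N.
Proof.
elim: r => [|r IHr]; first by rewrite /rising_nat big_ord0 mul1n addn0.
rewrite /rising_nat big_ord_recr /= -/(rising_nat n.+1 r) mulnAC IHr.
by rewrite addnS factS mulnC addSn.
Qed.

(** Telescoping; the order is positive, so the rising factorial vanishes at [0]. *)
Lemma sum_rising_nat n r : (\sum_(i < n) r.+1 * rising_nat i.+1 r = rising_nat n r.+1)%N.
Proof.
elim: n => [|n IHn]; last by rewrite big_ord_recr /= IHn rising_natSS.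
by rewrite big_ord0 /rising_nat big_ord_recl mul0n.
Qed.

Lemma rising_factorial_nat (R : realType) n r :
  rising_factorial (n%:R : R)%:E r = (rising_nat n r)%:R%:E.
Proof.
rewrite /rising_nat natr_prod -prodEFin; apply: eq_bigr => i _.
by rewrite -EFinD natrD.
Qed.

Lemma rising_factorial_pinfty (R : realType) r :
  rising_factorial (+oo : \bar R)%E r.+1 = +oo%E.
Proof.
rewrite /rising_factorial; elim: r => [|r IHr].
  by rewrite big_ord_recl big_ord0 mule1.
by rewrite big_ord_recr /= IHr addye // mulyy.
Qed.

(* [S] may be empty: both sides are then [+oo]. *)
Lemma rising_factorial_hitting_time (R : realType) (S : set nat) r :
  (forall m n, (m <= n)%N -> S m -> S n) ->
  rising_factorial (ereal_inf [set (n%:R : R)%:E | n in S]) r.+1 =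
  (\sum_(n <oo) ((r.+1 * rising_nat n.+1 r)%:R * \1_(~` S) n)%:E)%E.
Proof.
move=> S_up.
have term_ge0 n : (0 <= ((r.+1 * rising_nat n.+1 r)%:R * \1_(~` S) n : R)%:E)%E.
  by rewrite lee_fin mulr_ge0.
have sum_before n : (forall i, (i < n)%N -> ~ S i) ->
    (\sum_(i < n) ((r.+1 * rising_nat i.+1 r)%:R * \1_(~` S) i : R)%:E =
     (rising_nat n r.+1)%:R%:E)%E.
  move=> nS; rewrite sumEFin -sum_rising_nat natr_sum; congr EFin.
  by apply: eq_bigr => i _; rewrite indicE mem_set ?mulr1 //; exact: nS.
have [[n0 Sn0]|S0] := pselect (exists n, S n); last first.
  have nS n : ~ S n by move=> Sn; apply: S0; exists n.
  rewrite (_ : [set _ | n in S] = set0); last first.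
    by apply/seteqP; split=> // x [n /nS].
  rewrite ereal_inf0 rising_factorial_pinfty; apply/esym/eqyP => A A_gt0.
  (* With [n] the truncation of [A] plus one, the first [n] terms sum to [rising_nat n r.+1], which
     is at least [n], hence at least [A]. *)
  apply: le_trans (nneseries_lim_ge (Num.truncn A).+1 _) => //.
  rewrite big_mkord sum_before // lee_fin (le_trans (ltW (truncnS_gt _))) //.
  by rewrite ler_nat /rising_nat big_ord_recl addn0 leq_pmulr // prodn_gt0.
have exS : exists n, `[< S n >] by exists n0; apply/asboolP.
case: (ex_minnP exS) => n1 /asboolP Sn1 n1_min.
have nS i : (i < n1)%N -> ~ S i.
  by move=> i_lt /asboolP/n1_min; rewrite leqNgt i_lt.
have -> : ereal_inf [set (n%:R : R)%:E | n in S] = n1%:R%:E.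
  apply/le_anti/andP; split; first by apply: ereal_inf_lbound; exists n1.
  apply: le_ereal_inf_tmp => _ [n Sn <-]; rewrite lee_fin ler_nat n1_min //.
  exact/asboolP.
(* The terms before the minimum [n1] telescope; those from [n1] on vanish because [S] is upward
   closed. *)
rewrite rising_factorial_nat (nneseries_split 0 n1) // add0n big_mkord sum_before //.
rewrite eseries0 ?adde0 // => i n1_le _.
by rewrite indicE memNset ?mulr0 // => nSi; apply: nSi; exact: S_up Sn1.
Qed.

(** * The gamma integral at integer arguments *)

Section GammaIntegral.
Variable R : realType.
Local Notation mu := (@lebesgue_measure R).

(* [t S_k(t) <= k S_(k+1)(t) <= k exp(t)], term by term. *)
Lemma cvg_exp_partial_sumMexpN k :
  exp_partial_sum k t * expR (- t) @[t --> +oo] --> (0 : R).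
Proof.
have S_ge0 n (t : R) : 0 <= t -> 0 <= exp_partial_sum n t.
  by move=> t_ge0; apply: sumr_ge0 => l _; rewrite divr_ge0 // exprn_ge0.
have cvg_kV : k%:R * t^-1 @[t --> +oo] --> (0 : R).
  rewrite -(mulr0 k%:R); apply: cvgM; first exact: cvg_cst.
  by apply/gtr0_cvgV0; [exact: nbhs_pinfty_gt|exact: cvg_id].
apply: (squeeze_cvgr _ (cvg_cst (0 : R)) cvg_kV); near=> t.
have t_gt0 : 0 < t by near: t; exact: nbhs_pinfty_gt.
rewrite mulr_ge0 ?expR_ge0 ?(S_ge0 _ _ (ltW t_gt0)) //=.
rewrite expRN ler_pdivrMr ?expR_gt0 // mulrAC ler_pdivlMr //.
apply: (@le_trans _ _ (k%:R * exp_partial_sum k.+1 t)); last first.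
  by rewrite ler_wpM2l // -subr_ge0; apply: exp_tail_ge0; exact: ltW.
rewrite /exp_partial_sum big_ord_recl expr0 fact0 divr1 mulrDr mulr1.
rewrite -[leLHS]add0r lerD // mulr_sumr mulr_suml.
apply: ler_sum => l _; rewrite /= /bump /= add1n.
have tl_ge0 : 0 <= t ^+ l.+1 / l.+1`!%:R by rewrite divr_ge0 // exprn_ge0 // ltW.
apply: (@le_trans _ _ (l.+1%:R * (t ^+ l.+1 / l.+1`!%:R))); last first.
  by rewrite ler_wpM2r // ler_nat.
rewrite factS natrM exprSr le_eqVlt; apply/orP; left; apply/eqP.
by field; rewrite -[1]/(1%:R) -natrD !pnatr_eq0 -lt0n fact_gt0.
Unshelve. all: by end_near. Qed.

Lemma continuous_exprMexpN k : continuous (fun t : R => t ^+ k * expR (- t)).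
Proof.
move=> t; apply: cvgM; first exact: exprn_continuous.
apply: (@continuous_comp _ _ _ (fun u : R => - u) expR).
  exact: opp_continuous.
exact: continuous_expR.
Qed.

Lemma integral_exprMexpN k :
  (\int[mu]_(t in `[0%R, +oo[) (t ^+ k * expR (- t))%:E = (k`!%:R)%:E)%E.
Proof.
(* An explicit antiderivative: since [S_(k+1)' = S_k], only the top term [t^k / k!] survives
   differentiation. It equals [- k!] at [0] and tends to [0] at infinity. *)
pose F (t : R) : R := - k`!%:R * (exp_partial_sum k.+1 t * expR (- t)).
have dF (t : R) : is_derive t 1 F (t ^+ k * expR (- t)).
  have dexpN : is_derive t 1 (fun u : R => expR (- u)) (expR (- t) * -1).
    exact: is_derive1_comp (is_derive_expR (- t)) (is_deriveNid t 1).
  have dS : is_derive t 1 (exp_partial_sum k.+1) (exp_partial_sum k t).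
    have -> : exp_partial_sum k.+1 = exp_poly (fun=> 1 : R) k.+1.
      by apply/funext => u; rewrite exp_partial_sumE.
    by rewrite exp_partial_sumE; exact: is_derive_exp_poly.
  apply: (is_derive_eq (is_deriveZ (- k`!%:R) (is_deriveM dS dexpN))).
  rewrite -[LHS]/(- k`!%:R * (exp_partial_sum k.+1 t * (expR (- t) * -1)
    + expR (- t) * exp_partial_sum k t)).
  rewrite {1}/exp_partial_sum big_ord_recr /= -/(exp_partial_sum k t).
  by field; rewrite pnatr_eq0 -lt0n fact_gt0.
rewrite (@ge0_continuous_FTC2y R _ F 0 0).
- rewrite /F oppr0 expR0 mulr1 exp_partial_sumE exp_poly_at0 mulr1 EFinN.
  by rewrite oppeK add0e.
- by move=> t t_ge0; rewrite mulr_ge0 ?expR_ge0 // exprn_ge0.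
- exact/continuous_subspaceT/continuous_exprMexpN.
- rewrite -(mulr0 (- k`!%:R)); apply: cvgM; first exact: cvg_cst.
  exact: cvg_exp_partial_sumMexpN.
- by move=> t _; have [] := dF t.
- apply: cvg_at_right_filter; apply: differentiable_continuous.
  by apply/derivable1_diffP; have [] := dF 0.
- by move=> t _; rewrite derive1E; exact: derive_val.
Qed.

End GammaIntegral.

(** * Poissonized series, expectation as a series, and the final identity *)

Lemma poissonization (R : realType) (N : nat) (p : 'I_N -> R)
    (a : 'I_N -> nat) (t : R) :
  (forall j, 0 <= p j) -> \sum_(j < N) p j = 1 -> 0 <= t ->
  (\sum_(n <oo) ((1 - covering_prob p n a) * (t ^+ n / n`!%:R))%:E =
   (expR t - prod_exp_tail p a t)%:E)%E.
Proof.
move=> p_ge0 p_sum1 t_ge0; apply/cvg_lim => //.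
under eq_cvg do rewrite sumEFin.
apply: cvg_EFin; first by near=> n.
rewrite -[X in _ --> X]subr0.
pose rem n := prod_exp_tail p a t - exp_poly (fun k => covering_prob p k a) n t.
(* The error [exp_tail n t - rem n] lies between [0] and [exp_tail n t] by the remainder bound, so
   it tends to [0]. *)
rewrite (_ : _ \o _ = fun n => expR t - prod_exp_tail p a t
    - (exp_tail n t - rem n)); last first.
  apply/funext => n /=; rewrite big_mkord.
  under eq_bigr do rewrite mulrBl mul1r.
  rewrite sumrB -/(exp_poly (fun k => covering_prob p k a) n t).
  rewrite -/(exp_partial_sum n t) /exp_tail /rem.
  ring.
apply: cvgB; first exact: cvg_cst.
apply: (squeeze_cvgr _ (cvg_cst (0 : R)) (cvg_exp_tail t)).
near=> n; rewrite /rem subr_ge0.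
have /andP[? ?] := prod_exp_tail_remainder p_ge0 p_sum1 n a t_ge0.
by apply/andP; split => //; rewrite lerBlDr lerDl.
Unshelve. all: by end_near. Qed.

(** As the [p_j] sum to [1], [exp(-t)] splits into one factor [exp(-p_j t)] per type. *)
Lemma prod_exp_tailE (R : realType) (N m : nat) (p : 'I_N -> R) (t : R) :
  \sum_(j < N) p j = 1 ->
  \prod_(j < N) (1 - exp_partial_sum m (p j * t) * expR (- (p j * t))) =
  expR (- t) * prod_exp_tail p (fun=> m) t.
Proof.
move=> p_sum1.
have -> : expR (- t) = \prod_(j < N) expR (- (p j * t)).
  by rewrite -expR_sum sumrN -mulr_suml p_sum1 mul1r.
rewrite /prod_exp_tail -big_split /=; apply: eq_bigr => j _.
by rewrite mulrBr [expR (- _) * expR _]mulrC expRxMexpNx_1 [in RHS]mulrC.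
Qed.

Lemma collection_timeE (R : realType) (Omega : Type) (N : nat)
    (X : nat -> Omega -> 'I_N) m w :
  collection_time R X m w =
  ereal_inf [set (n%:R)%:E | n in [set n | covering X 0 n (fun=> m) w]].
Proof.
have countE n j : num_drawn X n j w = (\sum_(i < n) (X (0 + i) w == j))%N.
  rewrite /num_drawn -sum1_card big_mkcond; apply: eq_bigr => i _.
  by rewrite inE; case: eqP.
rewrite /collection_time; congr (ereal_inf (_ @` _)).
by apply/seteqP; split=> n /= cov j; have := cov j; rewrite countE.
Qed.

(** The hitting-time expansion holds pointwise, even where the time is infinite; its terms are
    nonnegative, so expectation and sum commute, leaving the probabilities that [n] draws do not
    suffice. *)
Lemma integral_rising_factorial_collection_time (R : realType)
    (d : measure_display) (Omega : measurableType d) (P : probability Omega R)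
    (N m : nat) (p : 'I_N -> R) (X : nat -> Omega -> 'I_N) (r : nat) :
  (0 < N)%N -> coupon_draws P p X ->
  (\int[P]_w rising_factorial (collection_time R X m w) r.+1 =
   \sum_(n <oo) ((r.+1 * rising_nat n.+1 r)%:R *
                 (1 - covering_prob p n (fun=> m)))%:E)%E.
Proof.
move=> N_gt0 drawsX; pose B n := covering X 0 n (fun=> m).
have mB n : measurable (~` B n) by exact/measurableC/(measurable_covering drawsX).
have B_up w k n : (k <= n)%N -> B k w -> B n w.
  move=> kn Bk j; apply: leq_trans (Bk j) _.
  rewrite -(subnKC kn) big_split_ord /=; exact: leq_addr.
pose g n w := ((r.+1 * rising_nat n.+1 r)%:R * \1_(~` B n) w : R)%:E.
transitivity (\int[P]_w (\sum_(n <oo) g n w))%E.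
  apply: eq_integral => w _.
  by rewrite collection_timeE rising_factorial_hitting_time //; exact: B_up.
have g_ge0 n w : setT w -> (0 <= g n w)%E by move=> _; rewrite lee_fin mulr_ge0.
rewrite integral_nneseries //; last first.
  by move=> n; apply/measurable_EFinP; exact: measurable_funM.
apply: eq_eseriesr => n _.
rewrite /g; under eq_integral do rewrite EFinM.
rewrite ge0_integralZl_EFin //; last exact/measurable_EFinP.
rewrite integral_indic // setIT EFinM; congr (_ * _)%E.
(* Any sequence of types would do, since a cylinder of length [0] is the whole space. *)
pose c (_ : nat) := Ordinal N_gt0.
have := probability_cylinderI_covering drawsX c 0 n (fun=> m).
rewrite (_ : cylinder X c 0 = setT); last by apply/seteqP; split.
rewrite setTI big_ord0 mul1r EFinB => <-; apply: probability_setC.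
exact: (measurable_covering drawsX).
Qed.

Theorem mainTheorem8 (R : realType) (d : measure_display)
  (Omega : measurableType d) (P : probability Omega R)
  (N m : nat) (N_gt0 : (0 < N)%N) (m_gt0 : (0 < m)%N)
  (p : 'I_N -> R) (p_gt0 : forall j, 0 < p j) (p_sum1 : \sum_(j < N) p j = 1)
  (X : nat -> Omega -> 'I_N) (drawsX : coupon_draws P p X)
  (r : nat) (r_gt0 : (0 < r)%N) :
  (\int[P]_w rising_factorial (collection_time R X m w) r =
   (r%:R)%:E * \int[lebesgue_measure]_(t in `[0%R, +oo[)
     ((1 - \prod_(j < N) (1 - exp_partial_sum m (p j * t) * expR (- (p j * t))))
        * t ^+ r.-1)%:E)%E.
Proof.
(* From here on the order is [r.+1], and the exponent of [t] is [r]. *)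
case: r r_gt0 => // r _.
rewrite (integral_rising_factorial_collection_time _ _ N_gt0 drawsX) /=.
have p_ge0 j : 0 <= p j by exact: ltW.
pose q n := covering_prob p n (fun=> m).
have q_ge0 n : 0 <= 1 - q n.
  by rewrite subr_ge0; case/andP: (covering_prob_itv p_ge0 p_sum1 n (fun=> m)).
pose f n (t : R) : \bar R := (((1 - q n) / n`!%:R)%:E * (t ^+ (n + r) * expR (- t))%:E)%E.
have e_ge0 n (t : R) : `[0%R, +oo[%classic t -> (0 <= (t ^+ n * expR (- t))%:E)%E.
  rewrite /= in_itv /= andbT => t_ge0.
  by rewrite lee_fin mulr_ge0 ?expR_ge0 // exprn_ge0.
have f_ge0 n (t : R) : `[0%R, +oo[%classic t -> (0 <= f n t)%E.
  by move=> t_ge0; rewrite mule_ge0 ?e_ge0 // lee_fin divr_ge0.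
have e_meas n : measurable_fun (`[0%R, +oo[%classic : set R)
    (fun t : R => (t ^+ n * expR (- t))%:E).
  apply/measurable_EFinP; apply: measurable_funTS.
  exact: continuous_measurable_fun (@continuous_exprMexpN R n).
transitivity ((r.+1%:R)%:E * \int[lebesgue_measure]_(t in `[0%R, +oo[)
    (\sum_(n <oo) f n t))%E; last first.
  congr (_ * _)%E; apply: eq_integral => t; rewrite inE /= in_itv /= andbT => t_ge0.
  rewrite (prod_exp_tailE _ _ p_sum1).
  (* Writing [1] as [exp(t) exp(-t)] brings out the factor [exp(t) - H_a(t)] that [poissonization]
     expands. *)
  rewrite (_ : (1 - _) * _ = t ^+ r * expR (- t) *
      (expR t - prod_exp_tail p (fun=> m) t)); last first.
    have eE : expR t * expR (- t) = 1 by exact: expRxMexpNx_1.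
    by rewrite -[in LHS]eE; ring.
  rewrite EFinM -poissonization // -nneseriesZl; last first.
    by move=> n _; rewrite lee_fin mulr_ge0 ?q_ge0 // divr_ge0 // exprn_ge0.
  apply: eq_eseriesr => n _; rewrite /f -!EFinM exprD; congr EFin.
  by rewrite -/(q n); ring.
(* Nonnegativity of the [f n] allows termwise integration, and each term is a gamma integral. *)
rewrite integral_nneseries //; last first.
  by move=> n; rewrite /f; apply: measurable_funeM; exact: e_meas.
rewrite -nneseriesZl; last first.
  by move=> n _; apply: integral_ge0 => t; exact: f_ge0.
apply: eq_eseriesr => n _.
rewrite ge0_integralZl_EFin //; [|exact: e_ge0|exact: e_meas|by rewrite divr_ge0].
rewrite integral_exprMexpN -!EFinM; congr EFin.
rewrite -/(q n) -rising_natS_fact !natrM.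
by field; rewrite pnatr_eq0 -lt0n fact_gt0.
Qed.
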